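(* For all integers $n,\lambda,r\ge 0$ and $m,x\ge 1$, $$D^{\lambda,x}_{m,r}(n)=\sum_{i=0}^{n}(\lambda x)^{i}\,S(n,i;0,m,r).$$
   Context: For integers $n,r,\lambda\ge 0$ and $m,x\ge 1$, $D^{\lambda,x}_{m,r}(n)$ (the higher order non-degenerate $r$-Dowling polynomial) is the number of $(r,m,x,\lambda)$-partitions of $\{1,\ldots,n+r\}$, i.e. set partitions of $\{1,\ldots,n+r\}$ carrying the following extra data. (i) The elements $1,\ldots,r$ lie in $r$ distinct blocks, called distinguished blocks; all other blocks are called non-distinguished. (ii) In each non-distinguished block every element except the largest one is colored independently with one of $m$ colors. (iii) Each non-distinguished block is colored independently with one of $x$ colors. (iv) Each non-distinguished block is assigned independently to one of $\lambda$ sections. (v) Neither the distinguished blocks nor their elements are colored. The generalized Stirling numbers $S(n,k;0,m,r)$ (non-degenerate case $\alpha=0$) are defined by $$\sum_{n\ge 0}S(n,k;0,m,r)\frac{z^n}{n!}=\frac{e^{rz}}{k!}\left(\frac{e^{mz}-1}{m}\right)^k .$$ The convention $0^0=1$ is used. *)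

(* Defs.v *)
From mathcomp Require Import all_boot all_order all_algebra.

Set Implicit Arguments.
Unset Strict Implicit.
Unset Printing Implicit Defensive.

Import GRing.Theory.

(* The ground set {1, ..., N} is represented by 'I_N: the ordinal of value j
   stands for the element j + 1, so the elements 1, ..., r are the ordinals
   of value < r. *)

Definition distinguished (N r : nat) (B : {set 'I_N}) : bool :=
  [exists i in B, (i < r)%N].

Definition is_largest (N : nat) (B : {set 'I_N}) (i : 'I_N) : bool :=
  (i \in B) && [forall j in B, (j <= i)%N].

(* Candidates (P, c, b, s): a family of blocks P, and partial functions giving
   the color c of an element, the color b and the section s of a block.  The
   value None means "not colored" (resp. "in no section"); requiring the exact
   domain of definition in [is_rmxl_partition] makes the encoding bijective. *)
Definition rmxl_data (N m x lam : nat) : finType :=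
  ({set {set 'I_N}} * {ffun 'I_N -> option 'I_m} *
   {ffun {set 'I_N} -> option 'I_x} * {ffun {set 'I_N} -> option 'I_lam})%type.

Definition is_rmxl_partition (N r m x lam : nat)
    (t : rmxl_data N m x lam) : bool :=
  let: (P, c, b, s) := t in
  [&& partition P [set: 'I_N],
      [forall i : 'I_N, forall j : 'I_N,
         [&& i < r, j < r & i != j]%N ==> (pblock P i != pblock P j)],
      [forall i : 'I_N, isSome (c i) ==
         ~~ distinguished r (pblock P i) && ~~ is_largest (pblock P i) i],
      [forall B : {set 'I_N}, isSome (b B) ==
         (B \in P) && ~~ distinguished r B]
    & [forall B : {set 'I_N}, isSome (s B) ==
         (B \in P) && ~~ distinguished r B]].

Definition dowling (lam x m r n : nat) : nat :=
  #|[set t : rmxl_data (n + r) m x lam | is_rmxl_partition r t]|.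

Local Open Scope ring_scope.

(* Formal power series over the rationals, given by their coefficients. *)
Definition fps : Type := nat -> rat.

Definition fps1 : fps := fun n => (n == 0%N)%:R.

Definition fps_mul (f g : fps) : fps :=
  fun n => \sum_(i < n.+1) f i * g (n - i)%N.

Definition fps_pow (f : fps) (k : nat) : fps := iter k (fps_mul f) fps1.

Definition fps_sub (f g : fps) : fps := fun n => f n - g n.

Definition fps_scale (a : rat) (f : fps) : fps := fun n => a * f n.

(* The series of exp (a z). *)
Definition fps_exp (a : rat) : fps := fun n => a ^+ n / n`!%:R.

Definition egf (a : nat -> rat) : fps := fun n => a n / n`!%:R.

(* e^(r z) / k! * ((e^(m z) - 1) / m)^k *)
Definition stirling_series (k m r : nat) : fps :=
  fps_scale k`!%:R^-1
    (fps_mul (fps_exp r%:R)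
       (fps_pow (fps_scale m%:R^-1 (fps_sub (fps_exp m%:R) fps1)) k)).

(* S(n, k; 0, m, r), read off its exponential generating function. *)
Definition stirling (n k m r : nat) : rat := n`!%:R * stirling_series k m r n.

Lemma stirling_egf (k m r : nat) :
  egf (fun n => stirling n k m r) =1 stirling_series k m r.
Proof.
move=> n; rewrite /egf /stirling mulrC mulKf //.
by rewrite Num.Theory.pnatr_eq0 -lt0n fact_gt0.
Qed.

(* Main.v *)
Require Import Defs.
From mathcomp Require Import all_boot all_order all_algebra.
From mathcomp Require Import ring.
Import GRing.Theory Num.Theory.
Local Open Scope ring_scope.

(** The theorem holds because both sides solve the same pair of recurrences.

    Put y = lam x.  Once the set partition is chosen, the colors and sections
    contribute m per non-largest element of a non-distinguished block and y per
    non-distinguished block, so the Dowling number is a sum over set partitions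
    of a product of block weights ([dowling_partition_sum]).  The condition
    that 1, ..., r lie in distinct blocks is local too: a block containing two
    of them gets weight 0, which kills the whole product
    ([prod_block_weight]).

    A sum of this product form over all partitions of an arbitrary set A is
    computed by singling out the block of one chosen element
    ([partition_sum_rec]).  Let G s n be the sum when A contains s of the
    elements 1, ..., r (marked elements) and n others.  If a marked element is
    chosen, the rest of its block is any set of unmarked elements, so
      G (s+1) n = sum_j C(n, j) G s (n - j);
    if there is no marked element left,
      G 0 (n+1) = sum_j C(n, j) y m^j G 0 (n - j).

    The polynomial H s n = sum_i y^i S(n, i; 0, m, s), called [dowling_poly],
    obeys the same recurrences.  Its exponential generating function in n is
    e^(s z) exp (y u), where u = (e^(m z) - 1) / m; the first recurrence is
    multiplication by e^z ([stirling_recr]), and the second one is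
    u' = e^(m z), that is (u^(k+1) / (k+1)!)' = e^(m z) u^k / k!
    ([stirling_rec0]).  Induction on the size of A then identifies G with H
    ([partition_sum_block_weight]). *)

(** * Power series given by their coefficients *)

Lemma fact_neq0 n : n`!%:R != 0 :> rat.
Proof. by rewrite pnatr_eq0 -lt0n fact_gt0. Qed.

Lemma eq_fps_mul (f f' g g' : fps) :
  f =1 f' -> g =1 g' -> fps_mul f g =1 fps_mul f' g'.
Proof. by move=> ef eg n; apply: eq_bigr => i _; rewrite ef eg. Qed.

(** Truncation at any order above n turns the product of series into a product
    of polynomials, from which commutativity and associativity are inherited. *)
Lemma fps_mulE (f g : fps) N n : (n < N)%N ->
  fps_mul f g n = ((\poly_(i < N) f i) * (\poly_(i < N) g i))`_n.
Proof.
move=> ltnN; rewrite coefM; apply: eq_bigr => i _; rewrite !coef_poly.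
by rewrite !(leq_ltn_trans _ ltnN) // ?leq_subr // -ltnS.
Qed.

Lemma fps_mulC (f g : fps) : fps_mul f g =1 fps_mul g f.
Proof. by move=> n; rewrite !(@fps_mulE _ _ n.+1) // mulrC. Qed.

Lemma fps_mulA (f g h : fps) :
  fps_mul f (fps_mul g h) =1 fps_mul (fps_mul f g) h.
Proof.
pose p (e : fps) n := \poly_(i < n.+1) e i.
move=> n; transitivity (p f n * (p g n * p h n))`_n; last first.
  rewrite mulrA coefM; apply: eq_bigr => i _.
  by rewrite (@fps_mulE f g n.+1) // coef_poly ltnS leq_subr.
rewrite coefM; apply: eq_bigr => i _.
by rewrite (@fps_mulE g h n.+1) ?ltnS ?leq_subr // coef_poly ltn_ord.
Qed.

Lemma fps_mul1 (f : fps) : fps_mul fps1 f =1 f.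
Proof.
move=> n; rewrite /fps_mul big_ord_recl big1 => [|i _].
  by rewrite /fps1 eqxx mul1r subn0 addr0.
by rewrite /fps1 /= mul0r.
Qed.

Lemma fps_mul_scaler a (f g : fps) :
  fps_mul f (fps_scale a g) =1 fps_scale a (fps_mul f g).
Proof.
by move=> n; rewrite /fps_mul /fps_scale mulr_sumr; apply: eq_bigr => i _;
  rewrite mulrCA.
Qed.

(** In terms of the numbers n! f_n, the product of series is the binomial
    convolution; this is how the binomial coefficients of the recurrences
    arise. *)
Lemma fact_fps_mul (f g : fps) n : n`!%:R * fps_mul f g n =
  \sum_(j < n.+1) 'C(n, j)%:R * (j`!%:R * f j) * ((n - j)`!%:R * g (n - j)%N).
Proof.
rewrite mulr_sumr; apply: eq_bigr => j _.
by rewrite -(bin_fact (ltn_ord j : (j <= n)%N)) !natrM; ring.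
Qed.

Lemma fps_expD a b : fps_mul (fps_exp a) (fps_exp b) =1 fps_exp (b + a).
Proof.
move=> n; apply: (mulfI (fact_neq0 n)); rewrite fact_fps_mul.
rewrite /fps_exp [RHS]mulrC divfK ?fact_neq0 // exprDn.
apply: eq_bigr => j _.
rewrite -[RHS]mulr_natl -mulrA ![_`!%:R * _]mulrC !divfK ?fact_neq0 //.
by rewrite [a ^+ j * _]mulrC.
Qed.

Lemma fps_exp0 : fps_exp 0 =1 fps1.
Proof.
by case=> [|n]; rewrite /fps_exp /fps1 expr0n /= ?mul0r ?divr1.
Qed.

Definition fps_deriv (f : fps) : fps := fun n => n.+1%:R * f n.+1.

Lemma fps_derivM (f g : fps) n : fps_deriv (fps_mul f g) n =
  fps_mul (fps_deriv f) g n + fps_mul f (fps_deriv g) n.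
Proof.
rewrite /fps_deriv /fps_mul mulr_sumr.
(* The factor n + 1 splits as i + (n + 1 - i) in the i-th term. *)
transitivity (\sum_(i < n.+2) (i%:R * f i * g (n.+1 - i)%N
                               + f i * ((n.+1 - i)%:R * g (n.+1 - i)%N))).
  apply: eq_bigr => i _; have le_i : (i <= n.+1)%N by rewrite -ltnS.
  by rewrite -{1}(subnKC le_i) natrD; ring.
rewrite big_split [X in X + _ = _]big_ord_recl [X in _ + X = _]big_ord_recr /=.
rewrite subnn !mulr0n !mul0r mulr0 add0r addr0.
by congr (_ + _); apply: eq_bigr => i _; rewrite ?subSS ?subSn // -ltnS.
Qed.

Lemma fps_pow_small (u : fps) k n :
  u 0%N = 0 -> (n < k)%N -> fps_pow u k n = 0.
Proof.
move=> u0; elim: k n => // k IHk n lt_nk.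
rewrite /= /fps_mul big_ord_recl u0 mul0r add0r.
apply: big1 => i _; rewrite IHk ?mulr0 // lift0.
case: n lt_nk i => [|n] lt_nk [i ?] //=.
by rewrite subSS (leq_ltn_trans (leq_subr _ _)).
Qed.

Lemma fps_deriv_pow (u : fps) k : fps_deriv (fps_pow u k.+1) =1
  fps_scale k.+1%:R (fps_mul (fps_deriv u) (fps_pow u k)).
Proof.
elim: k => [|k IHk] n.
  rewrite -[fps_pow u 1]/(fps_mul u fps1) fps_derivM [X in _ + X]big1 ?addr0.
    by rewrite /fps_scale mul1r.
  by move=> i _; rewrite /fps_deriv /fps1 !mulr0.
rewrite -[fps_pow u k.+2]/(fps_mul u (fps_pow u k.+1)) fps_derivM.
rewrite (eq_fps_mul _ _ _ _ (fun=> erefl) IHk) fps_mul_scaler /fps_scale.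
rewrite fps_mulA (eq_fps_mul _ _ _ _ (fps_mulC _ _) (fun=> erefl)) -fps_mulA.
by rewrite [k.+2%:R]mulrS mulrDl mul1r.
Qed.

(** * Recurrences for the generalized Stirling numbers *)

Section Stirling.
Variable m : nat.
Hypothesis m_gt0 : (0 < m)%N.

(** Up to the factor y, this is the exponential generating function of a single
    non-distinguished block. *)
Definition block_series : fps :=
  fps_scale m%:R^-1 (fps_sub (fps_exp m%:R) fps1).
Local Notation u := block_series.

Lemma fps_deriv_block_series : fps_deriv u =1 fps_exp m%:R.
Proof.
move=> n; rewrite /fps_deriv /block_series
  /fps_scale /fps_sub /fps_exp /fps1 /= subr0.
rewrite factS natrM exprS.
have m0 : m%:R != 0 :> rat by rewrite pnatr_eq0 -lt0n.
by rewrite invfM; field; rewrite fact_neq0 m0 -(natrD _ 1 n) pnatr_eq0.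
Qed.

Lemma block_series0 : u 0%N = 0.
Proof.
by rewrite /block_series /fps_scale /fps_sub /fps_exp /fps1 divr1 subrr mulr0.
Qed.

Lemma stirlingE n k r : stirling n k m r =
  n`!%:R * (k`!%:R^-1 * fps_mul (fps_exp r%:R) (fps_pow u k) n).
Proof. by []. Qed.

Lemma stirling0E n k :
  stirling n k m 0 = n`!%:R * (k`!%:R^-1 * fps_pow u k n).
Proof.
by rewrite stirlingE (eq_fps_mul _ _ _ _ fps_exp0 (fun=> erefl)) fps_mul1.
Qed.

Lemma stirling_small n k r : (n < k)%N -> stirling n k m r = 0.
Proof.
move=> lt_nk; rewrite stirlingE /fps_mul big1 ?mulr0 // => i _.
by rewrite fps_pow_small ?block_series0 ?mulr0 //
  (leq_ltn_trans (leq_subr _ _)).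
Qed.

(** This is e^((r+1) z) = e^z e^(r z), read coefficientwise. *)
Lemma stirling_recr n k r : stirling n k m r.+1 =
  \sum_(j < n.+1) 'C(n, j)%:R * stirling (n - j) k m r.
Proof.
rewrite stirlingE.
have e : fps_exp r.+1%:R =1 fps_mul (fps_exp 1) (fps_exp r%:R).
  by move=> i; rewrite fps_expD -[r.+1%:R]natr1.
rewrite (eq_fps_mul _ _ _ _ e (fun=> erefl)) -fps_mulA mulrCA fact_fps_mul.
rewrite mulr_sumr; apply: eq_bigr => j _; rewrite stirlingE.
rewrite [_ * fps_exp _ _]mulrC /fps_exp divfK ?fact_neq0 // expr1n.
ring.
Qed.

(** This is the equation (u^(k+1) / (k+1)!)' = e^(m z) u^k / k!, read
    coefficientwise. *)
Lemma stirling_rec0 n k : stirling n.+1 k.+1 m 0 =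
  \sum_(j < n.+1) 'C(n, j)%:R * m%:R ^+ j * stirling (n - j) k m 0.
Proof.
have := fps_deriv_pow u k n; rewrite /fps_scale.
rewrite (eq_fps_mul _ _ _ _ fps_deriv_block_series (fun=> erefl)).
rewrite /fps_deriv => e.
have k0 : k.+1%:R != 0 :> rat by rewrite pnatr_eq0.
have -> : stirling n.+1 k.+1 m 0 =
   k`!%:R^-1 * (n`!%:R * fps_mul (fps_exp m%:R) (fps_pow u k) n).
  rewrite stirling0E !factS !natrM invfM -[RHS](mulKf k0).
  transitivity (k.+1%:R^-1 * k`!%:R^-1 * n`!%:R
                * (n.+1%:R * fps_pow u k.+1 n.+1)); first by ring.
  by rewrite e; ring.
rewrite fact_fps_mul mulr_sumr; apply: eq_bigr => j _; rewrite stirling0E.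
by rewrite [_ * fps_exp _ _]mulrC /fps_exp divfK ?fact_neq0 //; ring.
Qed.

Lemma stirling_n0 n : stirling n 0 m 0 = (n == 0%N)%:R.
Proof.
rewrite stirling0E invr1 mul1r /= /fps1.
by case: n => [|n]; rewrite ?mulr1 ?mulr0.
Qed.

Section DowlingPoly.
Variable y : rat.

Definition dowling_poly r n : rat :=
  \sum_(0 <= i < n.+1) y ^+ i * stirling n i m r.

(** A common summation range for all the indices n - j occurring in a
    recurrence, so that the two sums can be exchanged. *)
Lemma dowling_poly_widen N r n : (n <= N)%N ->
  dowling_poly r n = \sum_(0 <= i < N.+1) y ^+ i * stirling n i m r.
Proof.
move=> le_nN; rewrite /dowling_poly.
rewrite (@big_cat_nat _ _ _ n.+1 0 N.+1) //= [X in _ + X]big_nat.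
rewrite [X in _ + X]big1 ?addr0 // => i /andP[lt _].
by rewrite stirling_small ?mulr0.
Qed.

Lemma dowling_poly00 : dowling_poly 0 0 = 1.
Proof. by rewrite /dowling_poly big_nat1 stirling_n0 mulr1. Qed.

Lemma dowling_poly_recr r n : dowling_poly r.+1 n =
  \sum_(j < n.+1) 'C(n, j)%:R * dowling_poly r (n - j).
Proof.
under [RHS]eq_bigr => j _ do
  rewrite (dowling_poly_widen n) ?leq_subr // mulr_sumr.
rewrite exchange_big; apply: eq_bigr => i _.
by rewrite stirling_recr mulr_sumr; apply: eq_bigr => j _; rewrite mulrCA.
Qed.

Lemma dowling_poly_rec0 n : dowling_poly 0 n.+1 =
  \sum_(j < n.+1) 'C(n, j)%:R * (y * m%:R ^+ j * dowling_poly 0 (n - j)).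
Proof.
rewrite {1}/dowling_poly big_nat_recl // stirling_n0 mulr0 add0r.
under [RHS]eq_bigr => j _ do
  rewrite (dowling_poly_widen n) ?leq_subr // !mulr_sumr.
rewrite exchange_big; apply: eq_bigr => i _.
rewrite stirling_rec0 mulr_sumr; apply: eq_bigr => j _.
by rewrite exprS; ring.
Qed.
End DowlingPoly.
End Stirling.

(** * Sums over set partitions *)

Section PartitionSum.
Variables (T : finType) (R : comPzSemiRingType) (f : {set T} -> R).

Definition partition_sum (A : {set T}) : R :=
  \sum_(P : {set {set T}} | partition P A) \prod_(B in P) f B.

Lemma partition_sum0 : partition_sum set0 = 1.
Proof.
rewrite /partition_sum (big_pred1 set0) ?big_set0 // => P.
by rewrite partition_set0.
Qed.

(** A partition of A is the block B of a together with a partition of the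
    complement of B in A. *)
Lemma partition_sum_rec (A : {set T}) a : a \in A ->
  partition_sum A =
  \sum_(B : {set T} | (a \in B) && (B \subset A))
     f B * partition_sum (A :\: B).
Proof.
move=> aA; rewrite /partition_sum.
rewrite (partition_big (fun P => pblock P a)
          (fun B : {set T} => (a \in B) && (B \subset A))) /=; last first.
  move=> P PA; have aP : a \in cover P by rewrite (cover_partition PA).
  by rewrite mem_pblock aP (partitionS PA) // pblock_mem.
apply: eq_bigr => B /andP[aB BA]; rewrite mulr_sumr.
have nBQ Q : partition Q (A :\: B) -> B \notin Q.
  move=> QA; apply/negP => BQ.
  by have /subsetP/(_ a aB) := partitionS QA BQ; rewrite inE aB.
rewrite (reindex_onto (fun Q => B |: Q) (fun P => P :\ B)) /=; last first.
  move=> P /andP[PA /eqP <-]; rewrite setD1K // pblock_mem //.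
  by rewrite (cover_partition PA).
apply: eq_big => [Q | Q /andP[/andP[PA _] /eqP <-]]; last first.
  by rewrite big_setU1 // !inE eqxx.
apply/andP/idP => [[/andP[PA _] /eqP <-] | QA].
  by rewrite partitionD1 // setU11.
have BP : B \in B |: Q by rewrite setU11.
have PA : partition (B |: Q) A.
  have <- : B :|: (A :\: B) = A by rewrite -{1}(setIidPr BA) setID.
  rewrite partitionU1 //; first by apply/set0Pn; exists a.
  by rewrite -setI_eq0 setIDA setIC setDIl setDv setI0.
rewrite PA (def_pblock (partition_trivIset PA) BP aB) eqxx.
by rewrite setU1K ?nBQ.
Qed.

End PartitionSum.

Arguments partition_sum {T R} f A.

Lemma sum_subset_card (T : finType) (R : pzSemiRingType) (D : {set T})
    (h : nat -> R) :
  \sum_(C : {set T} | C \subset D) h #|C| =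
  \sum_(j < #|D|.+1) 'C(#|D|, j)%:R * h j.
Proof.
rewrite (partition_big (fun C : {set T} => inord #|C| : 'I_#|D|.+1) predT) //=.
apply: eq_bigr => j _; rewrite -cards_draws.
rewrite mulr_natl -sumr_const; apply: eq_big => [C | C].
  rewrite inE; apply: andb_id2l => CD.
  by rewrite -val_eqE /= inordK // ltnS subset_leq_card.
by case/andP=> CD /eqP <-; rewrite inordK // ltnS subset_leq_card.
Qed.

Lemma sum_superset1 (T : finType) (R : nmodType) (D : {set T}) a
    (F : {set T} -> R) :
  a \notin D ->
  \sum_(B : {set T} | (a \in B) && (B \subset a |: D)) F B =
  \sum_(C : {set T} | C \subset D) F (a |: C).
Proof.
move=> aD; rewrite (reindex_onto (fun C => a |: C) (fun B => B :\ a)) /=.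
  apply: eq_bigl => C; rewrite setU11 /= subUset sub1set setU11 /=.
  apply/andP/idP => [[CaD /eqP <-] | CD].
    by rewrite subDset subUset sub1set setU11.
  rewrite (subset_trans CD) ?subsetUr // setU1K //.
  by apply: contra aD; apply: (subsetP CD).
by move=> B /andP[aB _]; rewrite setD1K.
Qed.

(** * Colored partitions as weighted partitions *)

(** The functions counted here are the partial functions with domain p. *)
Lemma card_partial_functions (T : finType) k (p : pred T) :
  #|[set g : {ffun T -> option 'I_k} | [forall i, isSome (g i) == p i]]|
  = (k ^ #|p|)%N.
Proof.
transitivity (#|predC1 (None : option 'I_k)| ^ #|p|)%N; last first.
  by rewrite cardC1 card_option card_ord.
rewrite -(card_pffun_on None) cardsE; apply: eq_card => g /=.
rewrite [LHS]inE; apply/forallP/pfamilyP => [gp | [gp gS] i].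
  split=> [|i pi]; last by have := gp i; rewrite !inE [p i]pi; case: (g i).
  apply/subsetP => i; have := gp i.
  by rewrite !inE; case: (g i) => // j /eqP/esym.
have [pi | npi] := boolP (p i).
  by have := gS i pi; rewrite !inE; case: (g i).
have : i \notin p by [].
by move/(contra (subsetP gp i)); rewrite !inE negbK => /eqP ->.
Qed.

Lemma card_not_largest N (B : {set 'I_N}) : B != set0 ->
  #|[pred i in B | ~~ is_largest B i]| = #|B|.-1.
Proof.
case/set0Pn => a aB.
case: (@arg_maxnP _ a (mem B) (@nat_of_ord N) aB) => z zB z_max.
rewrite [#|B| in RHS](cardsD1 z) [z \in B]zB /=; apply: eq_card => i.
rewrite !inE andbC; apply: andb_id2r => iB; congr (~~ _).
rewrite /is_largest iB /=; apply/forall_inP/eqP => [i_max | -> j /z_max //].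
by apply/val_inj/anti_leq/andP; split; [apply: z_max | apply: i_max].
Qed.

Section Weight.
Variables (N r m x lam : nat).
Implicit Types (B : {set 'I_N}) (P : {set {set 'I_N}}).

Definition marked : {set 'I_N} := [set i : 'I_N | (i < r)%N].

(** The number of ways to decorate B as a block, for y = lam x.  In a
    non-distinguished block of size k, k - 1 elements are colored; the value 0
    excludes the blocks in which two elements that must be separated meet. *)
Definition block_weight (y : rat) B : rat :=
  if #|B :&: marked| == 0%N then y * m%:R ^+ #|B|.-1
  else (#|B :&: marked| == 1%N)%:R.

Lemma distinguishedE B : distinguished r B = (#|B :&: marked| != 0%N).
Proof.
rewrite cards_eq0; apply/exists_inP/set0Pn => [[i iB ir] | [i]].
  by exists i; rewrite !inE iB.
by rewrite !inE => /andP[iB ir]; exists i.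
Qed.

Definition separated P : bool :=
  [forall i : 'I_N, forall j : 'I_N,
     [&& i < r, j < r & i != j]%N ==> (pblock P i != pblock P j)].

(** Pairwise separation of the marked elements is a condition on each block on
    its own, hence can be carried by the weights. *)
Lemma separatedE P : partition P setT ->
  separated P = [forall B in P, #|B :&: marked| <= 1]%N.
Proof.
move=> PT; have tP := partition_trivIset PT.
have iP i : i \in cover P by rewrite (cover_partition PT).
apply/idP/forall_inP => [sP B BP | sP].
  apply/card_le1_eqP => i j; rewrite !inE => /andP[iB ir] /andP[jB jr].
  apply/eqP/negPn/negP => nij.
  have /forallP/(_ i)/forallP/(_ j) := sP.
  by rewrite ir jr eq_sym nij (def_pblock tP BP iB) (def_pblock tP BP jB) eqxx.
apply/forallP => i; apply/forallP => j; apply/implyP => /and3P[ir jr].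
apply: contra => /eqP eij; apply/eqP.
have /card_le1_eqP le1 := sP _ (pblock_mem (iP i)).
by apply: le1; rewrite !inE ?mem_pblock ?iP // eij mem_pblock iP.
Qed.

Definition nondistinguished P : {set {set 'I_N}} :=
  [set B in P | ~~ distinguished r B].

Definition colored_elements P : {set 'I_N} :=
  [set i | ~~ distinguished r (pblock P i) && ~~ is_largest (pblock P i) i].

(** With P fixed, the three partial functions can be chosen independently, as
    only their domains are prescribed. *)
Lemma dowling_fiber P : partition P setT -> separated P ->
  #|[set t : rmxl_data N m x lam | is_rmxl_partition r t & t.1.1.1 == P]| =
  (m ^ #|colored_elements P| * (lam * x) ^ #|nondistinguished P|)%N.
Proof.
move=> PT sP.
pose C := [set c : {ffun 'I_N -> option 'I_m} |
   [forall i, isSome (c i) == (i \in colored_elements P)]].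
pose D k := [set b : {ffun {set 'I_N} -> option 'I_k} |
   [forall B, isSome (b B) == (B \in nondistinguished P)]].
transitivity #|setX (setX (setX [set P] C) (D x)) (D lam)|.
  apply: eq_card => -[[[Q c] b] s]; rewrite !inE /= andbC.
  have [-> | //] := eqVneq Q P; rewrite PT /= -/(separated P) sP /=.
  rewrite -andbA; congr [&& _, _ & _]; apply: eq_forallb => i;
    by rewrite inE.
by rewrite !cardsX cards1 mul1n !card_partial_functions expnMn mulnA mulnAC.
Qed.

Lemma expn_colored_elements P : partition P setT ->
  (m ^ #|colored_elements P| =
   \prod_(B in P | ~~ distinguished r B) m ^ #|B|.-1)%N.
Proof.
move=> PT; have tP := partition_trivIset PT.
rewrite -prod_nat_const big_mkcondr.
rewrite (eq_bigl (fun i => (i \in cover P) && (i \in colored_elements P))).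
  rewrite big_trivIset_cond //=; apply: eq_bigr => B BP.
  have nB0 : B != set0 by apply: (partition_neq0 PT).
  transitivity (\prod_(i in B | ~~ distinguished r B && ~~ is_largest B i) m)%N.
    apply: eq_bigl => i; rewrite inE; apply: andb_id2l => iB.
    by rewrite (def_pblock tP BP iB).
  case: ifP => dB; last by rewrite big_pred0 // => i; rewrite andbF.
  by rewrite prod_nat_const -(@card_not_largest N).
by move=> i; rewrite (cover_partition PT) !inE.
Qed.

Lemma prod_block_weight P : partition P setT ->
  \prod_(B in P) block_weight (lam * x)%:R B =
  if separated P then (m ^ #|colored_elements P|
                       * (lam * x) ^ #|nondistinguished P|)%:R else 0.
Proof.
move=> PT; rewrite separatedE //; case: ifPn => [/forall_inP le1|]; last first.
  case/forall_inPn => B BP; rewrite -ltnNge => gt1.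
  rewrite (bigD1 B) //= /block_weight ifN ?mul0r //; last by case: #|_| gt1.
  by case: #|_| gt1 => [|[|k]]; rewrite ?mul0r.
have -> : ((lam * x) ^ #|nondistinguished P| =
           \prod_(B in P | ~~ distinguished r B) (lam * x))%N.
  by rewrite -prod_nat_const; apply: eq_bigl => B; rewrite inE.
rewrite expn_colored_elements //.
rewrite -big_split /= natr_prod [LHS](bigID (distinguished r)) /=.
rewrite big1 ?mul1r => [|B /andP[BP]].
  apply: eq_bigr => B /andP[BP]; rewrite distinguishedE negbK /block_weight.
  by move->; rewrite -natrX -natrM mulnC.
rewrite distinguishedE /block_weight; have := le1 B BP.
by case: #|_| => [|[]].
Qed.

Lemma dowling_partition_sum :
  #|[set t : rmxl_data N m x lam | is_rmxl_partition r t]|%:R =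
  partition_sum (block_weight (lam * x)%:R) setT.
Proof.
rewrite -sum1_card (partition_big (fun t : rmxl_data N m x lam => t.1.1.1)
  (fun P => partition P setT && separated P)) /=; last first.
  by move=> [[[P c] b] s]; rewrite inE => /and5P[-> sP _ _ _].
rewrite natr_sum /partition_sum big_mkcondr /=; apply: eq_bigr => P PT.
rewrite prod_block_weight //; case: ifP => // sP.
rewrite -dowling_fiber // -sum1_card; congr _%:R.
by apply: eq_bigl => t; rewrite !inE.
Qed.

(** Arbitrary subsets A are needed here, since removing a block leaves an
    arbitrary set of remaining elements. *)
Lemma partition_sum_block_weight (y : rat) : (0 < m)%N -> forall A : {set 'I_N},
  partition_sum (block_weight y) A =
  dowling_poly m y #|A :&: marked| #|A :\: marked|.
Proof.
move=> m_gt0 A; move: {2}#|A| (leqnn #|A|) => n; elim: n A => [|n IHn] A.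
  rewrite leqn0 cards_eq0 => /eqP ->.
  by rewrite set0I set0D cards0 partition_sum0 dowling_poly00.
move=> leAn; have [AR0 | [a]] := set_0Vmem (A :&: marked); last first.
  rewrite inE => /andP[aA aR]; rewrite (partition_sum_rec _ _ _ _ a) //.
  have aD : a \notin A :\: marked by rewrite inE aR.
  have sDA : a |: (A :\: marked) \subset A.
    by rewrite subUset sub1set aA subsetDl.
  (* The block of a marked element contributes only if its other elements are
     unmarked. *)
  rewrite (bigID (fun B : {set 'I_N} => B \subset a |: (A :\: marked))) /=.
  rewrite [X in _ + X]big1 ?addr0 => [|B /andP[/andP[aB BA]]]; last first.
    case/subsetPn => b bB; rewrite !inE negb_or => /andP[nba].
    rewrite negb_and (subsetP BA b bB) orbF negbK => br.
    have: (1 < #|B :&: marked|)%N.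
      rewrite (cardsD1 a) inE aB aR add1n ltnS card_gt0; apply/set0Pn.
      by exists b; rewrite !inE nba bB.
    by rewrite /block_weight; case: #|_| => [|[|k]]; rewrite ?mul0r.
  rewrite (eq_bigl (fun B : {set 'I_N} =>
             (a \in B) && (B \subset a |: (A :\: marked)))); last first.
    move=> B; rewrite -andbA; congr andb.
    by apply: andb_idl => sB; apply: subset_trans sDA.
  rewrite sum_superset1 // [#|A :&: marked|](cardsD1 a) inE aA aR add1n.
  rewrite dowling_poly_recr //.
  rewrite -(sum_subset_card _ _ _
    (fun j => dowling_poly m y #|A :&: marked :\ a| (#|A :\: marked| - j))).
  apply: eq_bigr => C CD.
  have aC : a \notin C by apply: contra aD; apply: (subsetP CD).
  have CA b : b \in C -> (b \notin marked) && (b \in A).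
    by move=> /(subsetP CD); rewrite inE.
  have -> : block_weight y (a |: C) = 1.
    rewrite /block_weight.
    suff -> : (a |: C) :&: marked = [set a] by rewrite cards1.
    apply/setP => b; rewrite in_setI in_setU1 in_set1.
    have [-> // | _ /=] := eqVneq b a.
    by apply/negP => /andP[/CA/andP[/negPf ->]].
  rewrite mul1r IHn; last first.
    rewrite -ltnS (leq_trans _ leAn) // (cardsD1 a A) aA add1n ltnS.
    by rewrite subset_leq_card // setDS // sub1set setU11.
  congr dowling_poly; first (apply: eq_card => b).
    rewrite in_setI in_setD in_setU1 in_setD1 in_setI negb_or.
    case: (boolP (b \in C)) => [/CA/andP[/negPf -> _] | _].
      by rewrite !andbF.
    by rewrite andbT andbA.
  rewrite -cardsDS //; apply: eq_card => b.
  rewrite !in_setD in_setU1 negb_or.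
  have [-> | _ /=] := eqVneq b a; first by rewrite aR /= andbF.
  by rewrite andbCA.
(* No marked element is left: the chosen element a has a non-distinguished
   block a |: C, of weight y m^#|C|. *)
have [-> | [a aA]] := set_0Vmem A.
  by rewrite set0I set0D cards0 partition_sum0 dowling_poly00.
have dA (C : {set 'I_N}) : C \subset A -> C :&: marked = set0.
  by move=> CA; apply/eqP; rewrite -subset0 -AR0 setSI.
have -> : A :\: marked = A by apply/setDidPl; rewrite -setI_eq0 AR0.
rewrite AR0 cards0 (partition_sum_rec _ _ _ _ a) //.
rewrite (eq_bigl (fun B : {set 'I_N} =>
           (a \in B) && (B \subset a |: A :\ a))); last by rewrite setD1K.
rewrite sum_superset1 ?setD11 // (cardsD1 a A) aA add1n dowling_poly_rec0 //.
rewrite -(sum_subset_card _ _ _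
  (fun j => y * m%:R ^+ j * dowling_poly m y 0 (#|A :\ a| - j))).
apply: eq_bigr => C CD.
have aC : a \notin C by apply: contra (subsetP CD a) _; rewrite setD11.
have CA : a |: C \subset A.
  by rewrite -(setD1K aA) setUS.
rewrite /block_weight dA // cards0 eqxx cardsU1 aC add1n /= IHn; last first.
  rewrite -ltnS (leq_trans _ leAn) // (cardsD1 a A) aA add1n ltnS.
  by rewrite subset_leq_card // setDS // sub1set setU11.
rewrite dA ?subsetDl // cards0; congr (_ * dowling_poly m y 0 _).
rewrite -cardsDS //.
suff /setDidPl -> : [disjoint A :\: (a |: C) & marked].
  by rewrite setDDl.
by rewrite -setI_eq0 dA ?subsetDl.
Qed.

End Weight.

Theorem theorem3p6 (n lam r m x : nat) (hm : (1 <= m)%N) (hx : (1 <= x)%N) :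
  (dowling lam x m r n)%:R =
  \sum_(0 <= i < n.+1) (lam * x)%:R ^+ i * stirling n i m r :> rat.
Proof.
have marked_card : #|marked (n + r) r| = r.
  have le_r : (r <= n + r)%N by rewrite leq_addl.
  have widen_inj : injective (widen_ord le_r).
    by move=> i j /(congr1 val) /= /val_inj.
  rewrite -[RHS]card_ord -(card_imset _ widen_inj).
  apply: eq_card => i; rewrite inE; apply/idP/imsetP => [ir | [j _ ->] //=].
  by exists (Ordinal ir) => //; apply: val_inj.
rewrite /dowling dowling_partition_sum partition_sum_block_weight // setTI.
by rewrite setTD [#|~: _|]cardsCs setCK marked_card card_ord addnK.
Qed.
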